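(* Let $g\in\mathcal{C}^2_+((1,\infty))$. For real $\alpha$ and $\beta>1$ consider the sequence $${\bf c}={\bf c}(\alpha,\beta)=\big(e^{2\pi i\,\alpha\beta^n g(\beta)}\big)_{n\in\mathbb{N}}.$$ Then: (i) for every fixed real number $\alpha\neq 0$, for Lebesgue-almost all real numbers $\beta>1$, the sequence ${\bf c}(\alpha,\beta)$ is multi-linearly disjoint; and (ii) for every fixed real number $\beta>1$, for Lebesgue-almost all real numbers $\alpha$, the sequence ${\bf c}(\alpha,\beta)$ is multi-linearly disjoint.
   Context: $\mathbb{N}=\{1,2,\dots\}$. $\mathcal{C}^2_+((1,\infty))$ is the space of all positive real-valued twice continuously differentiable functions on $(1,\infty)$ whose $i$-th derivatives are nonnegative for $i\leq 2$. A sequence ${\bf c}=(c_n)_{n\in\mathbb{N}}$ of complex numbers is multi-linearly disjoint if $$\lim_{N\to\infty}\frac1N\sum_{n=1}^N c_{n+l_1}^{k_1}c_{n+l_2}^{k_2}\cdots c_{n+l_r}^{k_r}=0$$ for all $r\geq 1$, all integers $0\leq l_1<l_2<\cdots<l_r$ and all $k_1,\dots,k_r\in\mathbb{N}$ such that not all of the equalities $c_{n+l_j}^{k_j}=|c_{n+l_j}|^{k_j}$ ($n\in\mathbb{N}$, $1\leq j\leq r$) hold. *)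

(* Defs.v *)
From HB Require Import structures.
From mathcomp Require Import all_boot all_order all_algebra.
From mathcomp Require Import all_classical all_reals all_analysis.
From mathcomp.real_closed Require Import complex.

Set Implicit Arguments.
Unset Strict Implicit.
Unset Printing Implicit Defensive.

Import Order.TTheory GRing.Theory Num.Theory.
Import numFieldNormedType.Exports.

Local Open Scope classical_set_scope.
Local Open Scope ring_scope.
Local Open Scope complex_scope.

(* C^k_+((1,oo)).  Functions on (1,oo) are represented by total functions
   R -> R whose values outside (1,oo) are irrelevant; since (1,oo) is open,
   differentiability and continuity at x > 1 only involve values near x. *)
Definition Ckplus (R : realType) (k : nat) (g : R -> R) : Prop :=
  forall x : R, 1 < x ->
    [/\ 0 < g x,
        forall i : nat, (i < k)%N -> derivable (g^`(i))%classic x 1,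
        {for x, continuous (g^`(k))%classic}
      & forall i : nat, (i <= k)%N -> 0 <= (g^`(i))%classic x].

(* e^{2 pi i t} *)
Definition e2pi (R : realType) (t : R) : R[i] :=
  cos (2 * pi * t) +i* sin (2 * pi * t).

(* Sequences indexed by {1, 2, ...} are represented by functions on nat; the
   value c 0 is never used.  The limit is taken in R[i]^o, which carries the
   topology of the complex modulus. *)
Definition multilinearly_disjoint (R : realType) (c : nat -> R[i]) : Prop :=
  forall (r : nat) (l k : 'I_r -> nat),
    (0 < r)%N ->
    (forall i j : 'I_r, (i < j)%N -> (l i < l j)%N) ->
    (forall j : 'I_r, (0 < k j)%N) ->
    ~ (forall n : nat, (0 < n)%N -> forall j : 'I_r,
         c (n + l j)%N ^+ k j = `|c (n + l j)%N| ^+ k j) ->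
    (N%:R^-1 * \sum_(1 <= n < N.+1) \prod_(j < r) c (n + l j)%N ^+ k j
       : R[i]^o) @[N --> \oo] --> (0 : R[i]^o).

Definition cseq (R : realType) (g : R -> R) (alpha beta : R) (n : nat) : R[i] :=
  e2pi (alpha * beta ^+ n * g beta).

(* Main.v *)
(* The products in the definition of multi-linear disjointness are
   [e(alpha beta^n P(beta) g(beta))] for a polynomial [P] with coefficients in N
   and [P >= 1] on [1, oo).  Expanding the square, the mean square of the N-th
   exponential sum over a compact parameter interval is a sum of integrals of
   [cos h] with [h = k (x^m - x^n) P(x) g(x)] (or [h] linear in the parameter);
   here [h'' >= 0] and [h' >= c m] for [n < m], so van der Corput's first
   derivative test bounds it by [O(N)].  Hence along N = M^2 the squared averages
   are summable in L^1 and tend to 0 almost everywhere; as the sums grow by at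
   most 1 per step, so do all the averages.  There are countably many products
   and intervals. *)
Require Import Defs.
From mathcomp Require Import all_boot all_order all_algebra.
From mathcomp Require Import all_classical all_reals all_analysis.
From mathcomp Require Import measurable_realfun.
From mathcomp.real_closed Require Import complex.
From mathcomp Require Import zify ring lra.

Import Order.TTheory GRing.Theory Num.Theory.
Import numFieldNormedType.Exports.

Local Open Scope classical_set_scope.
Local Open Scope ring_scope.

(** * Van der Corput's first derivative test as a bound on integrals *)

(* A certificate for [\int_a^b u <= C] that composes without integrability
   side conditions. *)
Definition upper_primitive {R : realType} (a b : R) (u : R -> R) (C : R) :=
  exists Phi phi : R -> R,
    (forall x, a <= x <= b ->
       [/\ is_derive x 1 Phi (phi x), {for x, continuous phi} & u x <= phi x])
    /\ Phi b - Phi a <= C.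

Lemma upper_primitiveD {R : realType} (a b : R) u v C D :
  upper_primitive a b u C -> upper_primitive a b v D ->
  upper_primitive a b (fun x => u x + v x) (C + D).
Proof.
move=> [F [f [Ff FC]]] [G [g [Gg GD]]]; exists (F + G), (f + g); split; last first.
  by rewrite !fctE; lra.
move=> x abx; have [dF cf uf] := Ff x abx; have [dG cg vg] := Gg x abx; split.
- exact: is_deriveD.
- exact: continuousD.
- exact: lerD.
Qed.

Lemma upper_primitiveZ {R : realType} (a b k : R) u C : 0 <= k ->
  upper_primitive a b u C -> upper_primitive a b (fun x => k * u x) (k * C).
Proof.
move=> k0 [F [f [Ff FC]]]; exists (k *: F), (k *: f); split; last first.
  by rewrite !fctE /= -scalerBr ler_wpM2l.
move=> x abx; have [dF cf uf] := Ff x abx; split.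
- exact: is_deriveZ.
- exact/continuousZr.
- exact: ler_wpM2l.
Qed.

Lemma upper_primitive_cst {R : realType} (a b k : R) :
  upper_primitive a b (fun=> k) (k * (b - a)).
Proof.
exists (k *: id), (cst k); split; last by rewrite !fctE /= -scalerBr.
move=> x abx; split => //; last exact: cst_continuous.
apply: is_derive_eq; exact: mulr1.
Qed.

Lemma upper_primitive_sum {R : realType} (a b : R) (I : eqType) (s : seq I)
    (u : I -> R -> R) (C : I -> R) :
  {in s, forall i, upper_primitive a b (u i) (C i)} ->
  upper_primitive a b (fun x => \sum_(i <- s) u i x) (\sum_(i <- s) C i).
Proof.
elim: s => [_|i s IH sP].
  have := upper_primitive_cst a b 0; rewrite mul0r big_nil.
  by under [X in _ -> upper_primitive _ _ X _]eq_fun do rewrite big_nil.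
under [X in upper_primitive _ _ X _]eq_fun do rewrite big_cons.
rewrite big_cons; apply: upper_primitiveD; first exact/sP/mem_head.
by apply: IH => j js; apply: sP; rewrite inE js orbT.
Qed.

(* [cos h <= cos h + (1 - sin h) h'' / h'^2 = ((sin h - 1) / h')']: a one-sided
   form of van der Corput's first derivative test. *)
Lemma upper_primitive_cos {R : realType} (a b lam : R) (h h1 h2 : R -> R) :
  a <= b -> 0 < lam ->
  (forall x, a <= x <= b ->
    [/\ is_derive x 1 h (h1 x), is_derive x 1 h1 (h2 x), {for x, continuous h2},
        lam <= h1 x & 0 <= h2 x]) ->
  upper_primitive a b (cos \o h) (2 / lam).
Proof.
move=> ab lam0 hP.
exists (fun x => (sin (h x) - 1) * (h1 x)^-1).
exists (fun x => cos (h x) + (1 - sin (h x)) * (h1 x)^-2 * h2 x).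
split=> [x abx|].
  have [dh dh1 ch2 lh1 h20] := hP x abx.
  have h1_gt0 : 0 < h1 x by exact: lt_le_trans lh1.
  have h1n0 : h1 x != 0 by rewrite gt_eqF.
  have ch : {for x, continuous h}.
    by apply/differentiable_continuous/derivable1_diffP; case: dh.
  have ch1 : {for x, continuous h1}.
    by apply/differentiable_continuous/derivable1_diffP; case: dh1.
  have csin : {for x, continuous (sin \o h)}.
    by apply: continuous_comp => //; exact: continuous_sin.
  split.
  - have dsin : is_derive x 1 (sin \o h) (cos (h x) * h1 x) by exact: is_derive1_comp.
    have dV := is_deriveV h1n0 dh1.
    have := is_deriveM (is_deriveB dsin (is_derive_cst (1 : R) x 1)) dV.
    move=> dM; apply: is_derive_eq dM _.
    rewrite !fctE /= /GRing.scale /= subr0.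
    by field.
  - apply: (@continuousD _ _ _ (cos \o h)
      (fun x => (1 - sin (h x)) * (h1 x)^-2 * h2 x)).
      by apply: continuous_comp => //; exact: continuous_cos.
    have c1sin : {for x, continuous (cst 1 - (sin \o h))}.
      by apply: continuousB => //; exact: cst_continuous.
    have cX : {for x, continuous (h1 * h1)} by exact: continuousM.
    have cV : {for x, continuous (fun x => (h1 x)^-2)}.
      by apply: (@continuousV _ _ (h1 * h1)) => //; exact: mulf_neq0.
    exact: continuousM (continuousM c1sin cV) ch2.
  - rewrite lerDl !mulr_ge0 ?subr_ge0 ?sin_le1 ?invr_ge0 ?sqr_ge0 //.
have [_ _ _ la _] : _ := hP a ltac:(by rewrite lexx ab).
have [_ _ _ lb _] : _ := hP b ltac:(by rewrite lexx ab).
have ga : 0 < h1 a by exact: lt_le_trans la.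
have gb : 0 < h1 b by exact: lt_le_trans lb.
have Bb : (sin (h b) - 1) * (h1 b)^-1 <= 0.
  by rewrite mulr_le0_ge0 ?subr_le0 ?sin_le1 // invr_ge0 ltW.
have Ba : (1 - sin (h a)) * (h1 a)^-1 <= 2 / lam.
  apply: ler_pM; rewrite ?subr_ge0 ?sin_le1 ?invr_ge0 ?(ltW ga) ?lef_pV2 //.
  by have := sin_geN1 (h a); lra.
by move: Ba Bb; lra.
Qed.

(** The fundamental theorem of calculus evaluates the integral of the continuous majorant [phi].
    Nonnegativity and measurability of [u] serve the comparison of the two integrals. *)
Lemma upper_primitive_integral {R : realType} (a b C : R) (u : R -> R) :
  a < b -> upper_primitive a b u C -> (forall x, a <= x <= b -> 0 <= u x) ->
  measurable_fun `[a, b] u ->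
  (\int[@lebesgue_measure R]_(x in `[a, b]) (u x)%:E <= C%:E)%E.
Proof.
move=> ab [F [f [Ff FC]]] u0 mu.
have cF x : a <= x <= b -> {for x, continuous F}.
  by case/Ff => -[dF _] _ _; exact/differentiable_continuous/derivable1_diffP.
have cf : {within `[a, b], continuous f}.
  apply: continuous_in_subspaceT => x; rewrite inE /= in_itv /= => abx.
  by case: (Ff x abx).
have FTC : (\int[@lebesgue_measure R]_(x in `[a, b]) (f x)%:E
    = (F b)%:E - (F a)%:E)%E.
  apply: continuous_FTC2 => //.
  - split=> [x|/=|/=].
    + rewrite in_itv /= => /andP[ax xb].
      by have [[]] := Ff x ltac:(by rewrite !ltW).
    + by apply: cvg_at_right_filter; apply: cF; rewrite lexx ltW.
    + by apply: cvg_at_left_filter; apply: cF; rewrite lexx ltW.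
  - move=> x; rewrite in_itv /= => /andP[ax xb].
    have [dF _ _] := Ff x ltac:(by rewrite !ltW).
    by rewrite derive1E; exact: derive_val.
apply: (@le_trans _ _ (\int[@lebesgue_measure R]_(x in `[a, b]) (f x)%:E)%E).
  apply: ge0_le_integral => //.
  - exact/measurable_EFinP.
  - apply/measurable_EFinP; apply: subspace_continuous_measurable_fun => //.
  - by move=> x; rewrite /= in_itv /= => abx; rewrite lee_fin; case: (Ff x abx).
by rewrite FTC -EFinB lee_fin.
Qed.

(** * From averages along perfect squares to all averages *)

Lemma exists_sqrtn (N : nat) : exists M, (M ^ 2 <= N < M.+1 ^ 2)%N.
Proof.
elim: N => [|N [M /andP[lo hi]]]; first by exists 0%N.
move: hi; rewrite leq_eqVlt => /predU1P[->|hi]; first by exists M.+1; nia.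
by exists M; rewrite hi ltnW.
Qed.

(** For [M ^ 2 <= N < M.+1 ^ 2], passing from [M ^ 2] to [N] adds at most [N - M ^ 2 <= 2 * M] to
    [w], which is negligible against [N]. *)
Lemma cvg_avg_squares {R : realType} (w : nat -> R) :
  (forall N, w N.+1 <= w N + 1) ->
  w (M.+1 ^ 2)%N / (M.+1 ^ 2)%:R @[M --> \oo] --> 0 ->
  (forall N, 0 <= w N) ->
  w N / N%:R @[N --> \oo] --> 0.
Proof.
move=> w1 wsq w0.
have wD N k : w (N + k)%N <= w N + k%:R.
  elim: k => [|k IH]; first by rewrite addn0 addr0.
  by rewrite addnS; have := w1 (N + k)%N; rewrite -(natr1 k); lra.
apply/cvgr0Pnorm_le => e e0.
have e20 : 0 < e / 2 by lra.
move/cvgr0Pnorm_le : wsq => /(_ _ e20)[M0 _ M0P].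
(* Once [4 / e <= M], the excess [2 * M] is at most [e / 2 * M ^ 2]; the value at the square
   contributes the other [e / 2 * M ^ 2]. *)
have [M1 M1P] : exists M1 : nat, 4 / e <= M1%:R.
  by exists (Num.truncn (4 / e)).+1; rewrite ltW // truncnS_gt.
exists ((M0 + M1).+1 ^ 2)%N => // N /= HN.
have [M /andP[lo hi]] := exists_sqrtn N.
have MM : (M0 + M1 < M)%N by nia.
have M_gt0 : 0 < M%:R :> R by rewrite ltr0n; lia.
have N_gt0 : 0 < N%:R :> R by rewrite ltr0n; nia.
rewrite ger0_norm ?divr_ge0 // ler_pdivrMr //.
(* The squares are indexed from [1 ^ 2], so [M ^ 2] is the term of index [M.-1]. *)
have := M0P M.-1 ltac:(rewrite /=; lia).
rewrite prednK; last by lia.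
rewrite ger0_norm ?divr_ge0 // ler_pdivrMr ?ltr0n ?expn_gt0; last by lia.
rewrite natrX => Hw.
have M4 : 4 <= e * M%:R.
  rewrite -ler_pdivrMl // mulrC (le_trans M1P) // ler_nat; lia.
have NM : (M%:R) ^+ 2 <= N%:R :> R by rewrite -natrX ler_nat.
have := wD (M ^ 2)%N (N - M ^ 2)%N; rewrite subnKC // => HN2.
have Nr : (N - M ^ 2)%:R <= 2 * M%:R :> R by rewrite -natrM ler_nat; nia.
apply: (@le_trans _ _ (e * M%:R ^+ 2)); last by rewrite ler_pM2l.
by nra.
Qed.

(** * Mean squares and almost everywhere convergence of exponential sums *)

Lemma cvg_complex0 {R : realType} (z : nat -> R[i]) (w : nat -> R) :
  (forall N, `|z N| = (w N)%:C%C) -> w N @[N --> \oo] --> 0 ->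
  (z N : R[i]^o) @[N --> \oo] --> (0 : R[i]^o).
Proof.
move=> zw /cvgr0Pnorm_lt w0; apply/cvgr0Pnorm_lt => -[e i].
(* The order on [R[i]] forces a positive radius to be real. *)
rewrite ltcE /= => /andP[/eqP -> e0].
have := w0 _ e0; apply: filterS => N; rewrite zw ltcR.
exact/le_lt_trans/ler_norm.
Qed.

(** This is the squared modulus of an exponential sum, expanded: the diagonal gives the ones, and
    each pair [n < m] occurs twice with the same cosine. *)
Lemma sqr_sum_cos_sin {R : realType} (t : nat -> R) N :
  (\sum_(1 <= n < N.+1) cos (t n)) ^+ 2 + (\sum_(1 <= n < N.+1) sin (t n)) ^+ 2 =
  \sum_(1 <= m < N.+1) (1 + 2 * \sum_(1 <= n < m) cos (t m - t n)).
Proof.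
elim: N => [|N IH]; first by rewrite !big_geq // expr0n /= addr0.
rewrite ![\sum_(1 <= _ < N.+2) _]big_nat_recr //= -IH.
under [in RHS]eq_bigr do rewrite cosB.
rewrite big_split /= -!mulr_sumr.
have := cos2Dsin2 (t N.+1).
set c := cos _; set s := sin _; set A := \sum_(_ <= _ < _) _.
set B := \sum_(_ <= _ < _) _ => cs.
by lra.
Qed.

(** Telescoping: [1 / (y + 1) ^ 2 <= 1 / y - 1 / (y + 1)], whence the sharper bound [2 - 1 / n] for
    [n >= 1], which carries the induction. *)
Lemma sum_inv_sqr_le {R : realType} (n : nat) :
  \sum_(0 <= M < n) ((M.+1 ^ 2)%:R^-1 : R) <= 2.
Proof.
case: n => [|n]; first by rewrite big_geq.
suff : \sum_(0 <= M < n.+1) ((M.+1 ^ 2)%:R^-1 : R) <= 2 - n.+1%:R^-1.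
  by move/le_trans; apply; rewrite gerBl.
elim: n => [|n IH].
  by rewrite big_nat1 exp1n invr1; lra.
rewrite big_nat_recr //=; apply: (le_trans (lerD IH (lexx _))).
rewrite natrX -(natr1 n.+1).
have : 1 <= n.+1%:R :> R by rewrite ler1n.
move: (n.+1%:R) => y y1.
have -> : y^-1 = (y + 1)^-1 + (y * (y + 1))^-1 by field; lra.
suff : (y + 1) ^- 2 <= (y * (y + 1))^-1 by lra.
by rewrite lef_pV2 ?posrE ?mulr_gt0 ?exprn_gt0 //; nra.
Qed.

(** The series of the [v n] can be integrated termwise and has integral at most [2 * L]. It is
    therefore finite almost everywhere, and the terms of a convergent series tend to 0. *)
Lemma ae_cvg0_of_summable {R : realType} (a b L : R) (v : nat -> R -> R) :
  (forall n, measurable_fun `[a, b] (v n)) ->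
  (forall n x, a <= x <= b -> 0 <= v n x) ->
  (forall n, (\int[@lebesgue_measure R]_(x in `[a, b]) (v n x)%:E
      <= (L / (n.+1 ^ 2)%:R)%:E)%E) ->
  {ae @lebesgue_measure R, forall x, a <= x <= b -> v n x @[n --> \oo] --> 0}.
Proof.
move=> mv v0 vL.
have mD : measurable (`[a, b]%classic : set R) by exact: measurable_itv.
have v0E n x : `[a, b]%classic x -> (0 <= (v n x)%:E)%E.
  by rewrite /= in_itv /= lee_fin => /v0.
have mvE n : measurable_fun `[a, b] (fun x => (v n x)%:E) by exact/measurable_EFinP.
have L0 : 0 <= L.
  have : (0 <= (L / (1 ^ 2)%:R)%:E)%E.
    by apply: le_trans (vL 0%N); apply: integral_ge0 => x; exact: v0E.
  by rewrite exp1n divr1 lee_fin.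
have Fint : (@lebesgue_measure R).-integrable `[a, b]
    (fun x => (\sum_(0 <= n <oo) (v n x)%:E)%E).
  apply/integrableP; split.
    by apply: (ge0_emeasurable_sum (P := xpredT)) => [n x xD _|n _]; [exact: v0E|exact: mvE].
  under eq_integral => x xD.
    rewrite gee0_abs; last by apply: nneseries_ge0 => n _ _; apply: v0E; rewrite inE in xD.
    over.
  rewrite integral_nneseries //.
  apply: (@le_lt_trans _ _ (2 * L)%:E); last exact: ltry.
  apply: lime_le.
    by apply: is_cvg_nneseries => n _ _; apply: integral_ge0 => x; exact: v0E.
  apply: nearW => n.
  apply: (le_trans (lee_sum _ (fun i _ => vL i))).
  rewrite sumEFin lee_fin -mulr_sumr mulrC ler_wpM2r //.
  exact: sum_inv_sqr_le.
apply: (filterS _ (integrable_ae _ Fint)) => // x + xab.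
have xD : `[a, b]%classic x by rewrite /= in_itv.
move=> /(_ xD) fin; apply: cvg_series_cvg_0; apply: nnseries_is_cvg.
  by move=> n; exact: v0.
by move: fin; rewrite fin_numElt => /andP[].
Qed.

(** The exponential without the factor [2 * pi], which is absorbed into the phase. *)
Definition expi {R : realType} (t : R) : R[i] := (cos t +i* sin t)%C.

Lemma sum_expi {R : realType} (t : nat -> R) N :
  \sum_(1 <= n < N) expi (t n)
  = ((\sum_(1 <= n < N) cos (t n)) +i* (\sum_(1 <= n < N) sin (t n)))%C.
Proof.
elim: N => [|N IH]; first by rewrite !big_geq.
have [N0|N0] := leqP N 0; first by rewrite !big_geq.
by rewrite !big_nat_recr //= IH.
Qed.

Lemma norm_sum_expi {R : realType} (t : nat -> R) N :
  `|\sum_(1 <= n < N.+1) expi (t n)| = (Num.sqrt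
    (\sum_(1 <= m < N.+1) (1 + 2 * \sum_(1 <= n < m) cos (t m - t n))))%:C%C.
Proof. by rewrite sum_expi normc_def /= sqr_sum_cos_sin. Qed.

Lemma norm_expi {R : realType} (t : R) : `|expi t| = 1.
Proof. by rewrite normc_def /= cos2Dsin2 sqrtr1. Qed.

(** For each [m] the [m - 1] correlations bounded by [K / m] contribute less than [K] in total, so
    the integral of the squared N-th sum is at most [N * L]. *)
Lemma ae_expi_averages {R : realType} (theta : nat -> R -> R) (a b K : R) :
  a < b -> 0 <= K ->
  (forall n, measurable_fun `[a, b] (theta n)) ->
  (forall m n, (0 < n < m)%N ->
     upper_primitive a b (fun x => cos (theta m x - theta n x)) (K / m%:R)) ->
  {ae @lebesgue_measure R, forall x, a <= x <= b ->
     (N%:R^-1 * \sum_(1 <= n < N.+1) expi (theta n x) : R[i]^o)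
       @[N --> \oo] --> (0 : R[i]^o)}.
Proof.
move=> ab K0 mtheta thetaP.
pose U N x :=
  \sum_(1 <= m < N.+1) (1 + 2 * \sum_(1 <= n < m) cos (theta m x - theta n x)).
have U0 N x : 0 <= U N x by rewrite /U -sqr_sum_cos_sin addr_ge0 ?sqr_ge0.
pose L := b - a + 2 * K.
have L0 : 0 <= L by rewrite addr_ge0 ?mulr_ge0 // subr_ge0 ltW.
have mU N : measurable_fun `[a, b] (U N).
  apply: measurable_sum => m; apply: measurable_funD => //.
  apply: measurable_funM => //; apply: measurable_sum => n.
  apply: (measurableT_comp (f := cos)).
    by apply: continuous_measurable_fun; exact: continuous_cos.
  exact: measurable_funB.
have intU N : (\int[@lebesgue_measure R]_(x in `[a, b]) (U N x)%:E
    <= (N%:R * L)%:E)%E.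
  pose C m := 1 * (b - a) + 2 * \sum_(1 <= n < m) K / m%:R.
  apply: (@le_trans _ _ (\sum_(1 <= m < N.+1) C m)%:E).
    apply: upper_primitive_integral => //.
    apply: upper_primitive_sum => m _; apply: upper_primitiveD.
      exact: upper_primitive_cst.
    apply: upper_primitiveZ => //; apply: upper_primitive_sum => n.
    by rewrite mem_index_iota => mn; exact: thetaP.
  rewrite lee_fin (_ : N%:R * L = \sum_(1 <= m < N.+1) L); last first.
    by rewrite big_const_nat iter_addr addr0 subn1 mulr_natl.
  rewrite big_nat [leRHS]big_nat; apply: ler_sum => m /andP[m0 _].
  rewrite /C /L mul1r lerD2l ler_wpM2l // big_const_nat iter_addr addr0.
  rewrite -mulrnAl -[leRHS]mulr1 -mulr_natr -mulrA ler_wpM2l //.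
  by rewrite ler_pdivrMr ?ltr0n // mul1r ler_nat leq_subr.
(* The squared modulus of the average of length [M.+1 ^ 2]; its integral is at most [L / M.+1 ^ 2],
   which is summable. *)
pose v M x := U (M.+1 ^ 2)%N x / (M.+1 ^ 2)%:R ^+ 2.
have : {ae @lebesgue_measure R, forall x, a <= x <= b ->
    v M x @[M --> \oo] --> 0}.
  apply: (ae_cvg0_of_summable _ _ L) => [M|M x _|M].
  - by apply: measurable_funM => //; exact: mU.
  - by rewrite divr_ge0 // sqr_ge0.
  under eq_integral do rewrite /v mulrC EFinM.
  rewrite ge0_integralZl_EFin //; last 2 first.
  - by move=> x _; rewrite lee_fin.
  - by apply/measurable_EFinP; exact: mU.
  apply: (@le_trans _ _ (((M.+1 ^ 2)%:R ^+ 2)^-1%:E * ((M.+1 ^ 2)%:R * L)%:E)%E).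
    by apply: lee_wpmul2l => //; rewrite lee_fin invr_ge0 sqr_ge0.
  have : (M.+1 ^ 2)%:R != 0 :> R by rewrite pnatr_eq0 expn_eq0.
  move: ((M.+1 ^ 2)%:R) => k k0; rewrite -EFinM lee_fin le_eqVlt.
  by apply/orP; left; apply/eqP; field.
apply: filterS; first exact: (ae_filter_ringOfSetsType (@lebesgue_measure R)).
move=> x + xab => /(_ xab) v_cvg.
pose w N := Num.sqrt (U N x).
have wE N : `|\sum_(1 <= n < N.+1) expi (theta n x)| = (w N)%:C%C.
  by rewrite norm_sum_expi.
apply: (@cvg_complex0 _ _ (fun N => w N / N%:R)).
  move=> N; rewrite normrM wE normfV normr_nat mulrC rmorphM /= fmorphV /=.
  by rewrite rmorph_nat.
apply: cvg_avg_squares => [N||N]; last exact: sqrtr_ge0.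
(* The comparison is moved into [R[i]], where the triangle inequality adds one term of modulus 1. *)
- rewrite -lecR rmorphD /= -!wE big_nat_recr //=.
  by rewrite (le_trans (ler_normD _ _)) // norm_expi.
- have : Num.sqrt (v M x) @[M --> \oo] --> Num.sqrt (0 : R).
    by apply: continuous_cvg => //; exact: sqrt_continuous.
  rewrite sqrtr0; apply: cvg_trans; apply: near_eq_cvg; apply: nearW => M.
  by rewrite /v sqrtrM // sqrtrV ?sqr_ge0 // sqrtr_sqr ger0_norm.
Qed.

(** * Bounds for the derivatives of polynomial phases *)

Lemma is_derive_derive1n {R : realType} (f : R -> R) n x :
  derivable (f^`(n))%classic x 1 ->
  is_derive x 1 (f^`(n))%classic ((f^`(n.+1))%classic x).
Proof. by move=> df; apply: DeriveDef => //; rewrite derive1nS derive1E. Qed.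

(** Since [n <= m - 1], the subtracted term [n x^(n-1)] is at most [m x^(m-2)]. What remains is at
    least [m x^(m-2) (x - 1)]. *)
Lemma deriv_XnBXn_ge {R : realType} (a x : R) (m n : nat) : 1 <= a -> a <= x ->
  (0 < n < m)%N -> m%:R * (a - 1) <= ('X^m - 'X^n : {poly R})^`().[x].
Proof.
case: m => [|[|m]]; case: n => [|n]; rewrite ?andbF //= !ltnS => a1 ax nm.
rewrite derivB !derivXn hornerD hornerN !hornerMn !hornerXn /=.
have x1 : 1 <= x by exact: le_trans ax.
have x0 : 0 <= x by exact: le_trans x1.
have xm1 : 1 <= x ^+ m by exact: exprn_ege1.
have xn : x ^+ n *+ n.+1 <= x ^+ m *+ m.+2.
  rewrite -[leLHS]mulr_natr -[leRHS]mulr_natr.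
  apply: ler_pM; rewrite ?exprn_ge0 //; first exact: ler_weXn2l.
  by rewrite ler_nat ltnS leqW.
apply: (@le_trans _ _ (x ^+ m.+1 *+ m.+2 - x ^+ m *+ m.+2)); last by rewrite lerB.
rewrite -mulrnBl -[leRHS]mulr_natl ler_wpM2l // exprS.
have -> : x * x ^+ m - x ^+ m = (x - 1) * x ^+ m by ring.
by rewrite -[leLHS]mulr1 ler_pM ?subr_ge0 // lerB.
Qed.

Lemma XnBXn_ge0 {R : realType} (x : R) (m n i : nat) : 1 <= x -> (n <= m)%N ->
  0 <= ('X^m - 'X^n : {poly R})^`(i).[x].
Proof.
move=> x1 nm; rewrite derivnB !derivnXn hornerD hornerN !hornerMn !hornerXn.
have x0 : 0 <= x by exact: le_trans x1.
rewrite subr_ge0 -[leLHS]mulr_natr -[leRHS]mulr_natr.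
(* Truncated subtraction is harmless here: both [n - i] and the falling factorial [n ^_ i] are
   monotone in [n], also when [i] exceeds [n]. *)
apply: ler_pM; rewrite ?exprn_ge0 //; first by rewrite ler_weXn2l // leq_sub2r.
by rewrite ler_nat; elim: i => // i IH; rewrite !ffactnSr leq_mul ?leq_sub2r.
Qed.

Lemma derivn_nneg_ge0 {R : realType} (p : {poly R}) n x :
  (forall i, 0 <= p`_i) -> 0 <= x -> 0 <= p^`(n).[x].
Proof.
move=> p0 x0; rewrite horner_coef; apply: sumr_ge0 => i _.
by rewrite mulr_ge0 ?exprn_ge0 // coef_derivn mulrn_wge0.
Qed.

(** * Exponential form of the products, and countable families of null sets *)

Lemma expiD {R : realType} (s t : R) : expi (s + t) = expi s * expi t.
Proof.
rewrite /expi cosD sinD; apply/eqP; rewrite eq_complex /= addrC.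
by rewrite [X in _ && (_ == X)]addrC !eqxx.
Qed.

Lemma expi_sum {R : realType} (I : Type) (s : seq I) (t : I -> R) :
  expi (\sum_(i <- s) t i) = \prod_(i <- s) expi (t i).
Proof.
apply: (big_morph expi) => [x y|]; first exact: expiD.
by rewrite /expi cos0 sin0.
Qed.

Lemma expiMn {R : realType} (t : R) n : expi (n%:R * t) = expi t ^+ n.
Proof.
elim: n => [|n IH]; first by rewrite mul0r /expi cos0 sin0.
by rewrite exprS -IH -expiD -natr1; congr expi; ring.
Qed.

(** The polynomial [P] for which the product over [j] has phase [2 * pi * alpha * beta ^ n * P(beta)
    * g(beta)]. *)
Definition freq_poly (R : realType) {r : nat} (l k : 'I_r -> nat) : {poly R} :=
  \sum_(j < r) (k j)%:R *: 'X^(l j).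

Lemma freq_poly_nneg (R : realType) r (l k : 'I_r -> nat) i :
  0 <= (freq_poly R l k)`_i.
Proof.
rewrite coef_sum; apply: sumr_ge0 => j _.
by rewrite coefZ coefXn mulr_ge0.
Qed.

Lemma freq_poly_ge1 (R : realType) r (l k : 'I_r -> nat) x : (0 < r)%N ->
  (forall j, (0 < k j)%N) -> 1 <= x -> 1 <= (freq_poly R l k).[x].
Proof.
move=> r0 k0 x1; rewrite horner_sum (bigD1 (Ordinal r0)) //= -[leLHS]addr0 lerD //.
  rewrite hornerZ hornerXn -[leLHS]mulr1 ler_pM ?ler1n //.
  exact: exprn_ege1.
apply: sumr_ge0 => j _; rewrite hornerZ hornerXn mulr_ge0 //.
by rewrite exprn_ge0 // (le_trans ler01).
Qed.

Lemma cseq_prod (R : realType) (g : R -> R) alpha beta n r (l k : 'I_r -> nat) :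
  \prod_(j < r) cseq g alpha beta (n + l j)%N ^+ k j =
  expi (2 * pi * alpha * (beta ^+ n * (freq_poly R l k).[beta]) * g beta).
Proof.
under eq_bigr do rewrite -[cseq _ _ _ _]/(expi _) -expiMn.
rewrite -expi_sum; congr expi.
rewrite horner_sum !mulr_sumr mulr_suml; apply: eq_bigr => j _.
by rewrite hornerZ hornerXn exprD; ring.
Qed.

(** The countable intersection over [nat] is transported along [pickle]; codes that decode to
    nothing carry the trivial condition. *)
Lemma ae_forall_countType d (T : measurableType d) (R : realType)
    (mu : {measure set T -> \bar R}) (I : countType) (P : I -> T -> Prop) :
  (forall i, {ae mu, forall x, P i x}) -> {ae mu, forall x, forall i, P i x}.
Proof.
move=> aeP; pose Q n x := if unpickle n is Some i then P i x else True.
have aeQ : {ae mu, forall x, forall n, Q n x}.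
  apply: ae_foralln => n; rewrite /Q; case: unpickle => [i|]; first exact: aeP.
  exact: filterE.
apply: filterS aeQ => x Qx i.
by have := Qx (pickle i); rewrite /Q pickleK.
Qed.

(** * Oscillation estimates for phases in beta and in alpha *)

Lemma within_continuous_Ckplus {R : realType} (g : R -> R) (a b : R) :
  Ckplus 2 g -> 1 < a -> {within `[a, b], continuous g}.
Proof.
move=> hg a1; apply: continuous_in_subspaceT => x.
rewrite inE /= in_itv /= => /andP[ax _].
have [_ /(_ 0%N isT) dg _ _] := hg x (lt_le_trans a1 ax).
exact/differentiable_continuous/derivable1_diffP.
Qed.

(** With [p = k (X^m - X^n) Q], the phase [p g] is a product of functions whose derivatives up to
    order 2 are nonnegative on the segment, so its second derivative is nonnegative. Its first
    derivative is at least [p' g >= k m (a - 1) c], where [c] bounds [g] from below. *)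
Lemma upper_primitive_phase {R : realType} (g : R -> R) (Q : {poly R}) (a b : R) :
  Ckplus 2 g -> 1 < a -> a < b -> (forall i, 0 <= Q`_i) ->
  (forall x, 1 <= x -> 1 <= Q.[x]) ->
  forall k : R, 0 < k -> exists2 K, 0 <= K & forall m n, (0 < n < m)%N ->
    upper_primitive a b
      (fun x => cos (k * ((x ^+ m - x ^+ n) * Q.[x]) * g x)) (K / m%:R).
Proof.
move=> hg a1 ab Q0 Q1 k k0.
have gtone x : a <= x <= b -> 1 < x by move=> /andP[ax _]; exact: lt_le_trans ax.
have gP x : a <= x <= b -> [/\ is_derive x 1 g ((g^`(1))%classic x),
    is_derive x 1 (g^`(1))%classic ((g^`(2))%classic x),
    {for x, continuous (g^`(2))%classic},
    0 <= (g^`(1))%classic x & 0 <= (g^`(2))%classic x].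
  move=> /gtone /hg[_ dg cg g0].
  split; [|exact: is_derive_derive1n (dg 1%N isT)|exact: cg|exact: (g0 1%N)|exact: (g0 2%N)].
  exact: (is_derive_derive1n g 0 x (dg 0%N isT)).
(* The minimum of [g] on the compact segment is attained, hence positive. *)
have [c gc cmin] : exists2 c, 0 < c & forall x, a <= x <= b -> c <= g x.
  have [|c cab cmin] := @EVT_min _ g a b (ltW ab).
    exact: within_continuous_Ckplus hg a1.
  exists (g c); last by move=> x xab; apply: cmin; rewrite in_itv.
  by have [] := hg c (gtone c ltac:(by move: cab; rewrite in_itv)).
pose lam := k * c * (a - 1).
have lam0 : 0 < lam by rewrite !mulr_gt0 // subr_gt0.
exists (2 / lam); first by rewrite divr_ge0 // ltW.
move=> m n nm; have m0 : 0 < m%:R :> R by rewrite ltr0n; lia.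
have -> : 2 / lam / m%:R = 2 / (lam * m%:R) :> R by rewrite -mulrA -invfM.
have nlem : (n <= m)%N by case/andP: nm => _ /ltnW.
(* [D] is kept opaque so that the product rule does not differentiate its two monomials. *)
have [D DE] : exists D : {poly R}, D = 'X^m - 'X^n by exists ('X^m - 'X^n).
pose p := k *: (D * Q).
pose h x := p.[x] * g x.
pose h1 x := p^`().[x] * g x + p.[x] * (g^`(1))%classic x.
pose h2 x := p^`()^`().[x] * g x + 2 * p^`().[x] * (g^`(1))%classic x
  + p.[x] * (g^`(2))%classic x.
have -> : (fun x => cos (k * ((x ^+ m - x ^+ n) * Q.[x]) * g x)) = cos \o h.
  by apply/funext => x; rewrite /= /h /p hornerZ hornerM DE hornerD hornerN !hornerXn.
apply: (upper_primitive_cos _ _ _ h h1 h2) => [||x xab]; [exact: ltW|exact: mulr_gt0|].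
have x1 := gtone x xab.
have x0 : 0 <= x by exact: le_trans ler01 (ltW x1).
have [dg dg1 cg2 g10 g20] := gP x xab.
have gx0 : 0 < g x by exact: lt_le_trans (cmin x xab).
have D0 i : 0 <= D^`(i).[x] by rewrite DE; apply: XnBXn_ge0 nlem; exact: ltW.
have Qn0 i : 0 <= Q^`(i).[x] by exact: derivn_nneg_ge0.
have p0 : 0 <= p.[x].
  by rewrite /p hornerZ hornerM mulr_ge0 ?(ltW k0) // mulr_ge0 // ?(D0 0%N) ?(Qn0 0%N).
have p1E : p^`().[x] = k * (D^`().[x] * Q.[x] + D.[x] * Q^`().[x]).
  by rewrite /p derivZ derivM hornerZ hornerD !hornerM.
have p2E : p^`()^`().[x] = k * (D^`()^`().[x] * Q.[x] + 2 * D^`().[x] * Q^`().[x]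
    + D.[x] * Q^`()^`().[x]).
  rewrite /p !derivZ derivM derivD !derivM hornerZ !hornerD !hornerM; ring.
have [D00 D10 D20] := And3 (D0 0%N) (D0 1%N) (D0 2%N).
have [Q00 Q10 Q20] := And3 (Qn0 0%N) (Qn0 1%N) (Qn0 2%N).
rewrite derivn0 in D00; rewrite derivn1 in D10.
rewrite derivn0 in Q00; rewrite derivn1 in Q10.
have p10 : 0 <= p^`().[x].
  by rewrite p1E mulr_ge0 ?(ltW k0) // addr_ge0 // mulr_ge0.
have p20 : 0 <= p^`()^`().[x].
  by rewrite p2E mulr_ge0 ?(ltW k0) // !addr_ge0 // !mulr_ge0.
have cp (q : {poly R}) : {for x, continuous (horner q)} by exact: continuous_horner.
have cg : {for x, continuous g}.
  by apply/differentiable_continuous/derivable1_diffP; case: dg.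
have cg1 : {for x, continuous (g^`(1))%classic}.
  by apply/differentiable_continuous/derivable1_diffP; case: dg1.
split.
- apply: is_derive_eq (is_deriveM (is_derive_poly p x) dg) _.
  by rewrite /h1 /GRing.scale /=; ring.
- apply: is_derive_eq (is_deriveD (is_deriveM (is_derive_poly p^`() x) dg)
    (is_deriveM (is_derive_poly p x) dg1)) _.
  by rewrite /h2 /GRing.scale /=; ring.
- have c2 : {for x, continuous (cst (2 : R))} by exact: cst_continuous.
  exact: continuousD (continuousD (continuousM (cp _) cg)
    (continuousM (continuousM c2 (cp p^`())) cg1)) (continuousM (cp p) cg2).
- apply: (@le_trans _ _ (p^`().[x] * g x)); last by rewrite lerDl mulr_ge0.
  have -> : lam * m%:R = k * (m%:R * (a - 1)) * c by rewrite /lam; ring.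
  have Da : m%:R * (a - 1) <= D^`().[x].
    by rewrite DE; apply: deriv_XnBXn_ge; [exact: ltW|case/andP: xab|].
  have Qx1 : 1 <= Q.[x] by apply: Q1; exact: ltW.
  rewrite ler_pM ?(ltW gc) ?cmin //.
    by rewrite !mulr_ge0 ?(ltW k0) ?(ltW m0) ?subr_ge0 // ltW.
  rewrite p1E ler_pM2l //; apply: (le_trans Da).
  rewrite -[leLHS]addr0 lerD ?mulr_ge0 //.
  by rewrite -[leLHS]mulr1 ler_wpM2l.
- by rewrite /h2 !addr_ge0 ?mulr_ge0 // ?(ltW gx0).
Qed.

Lemma natr_le_expr {R : realType} (x : R) (m : nat) : 1 <= x ->
  m%:R * (x - 1) <= x ^+ m.
Proof.
move=> x1; elim: m => [|m IH]; first by rewrite mul0r expr0.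
have : 1 <= x ^+ m by exact: exprn_ege1.
by rewrite exprS -natr1; nra.
Qed.

(** The slope is constant: [beta^m - beta^n >= beta^m (beta - 1) / beta], and the Bernoulli-type
    bound [beta^m >= m (beta - 1)] makes it at least [lam * m]. *)
Lemma upper_primitive_linear_phase {R : realType} (a b beta : R) :
  a < b -> 1 < beta ->
  forall k : R, 0 < k -> exists2 K, 0 <= K & forall m n, (0 < n < m)%N ->
    upper_primitive a b (fun x => cos (k * (beta ^+ m - beta ^+ n) * x)) (K / m%:R).
Proof.
move=> ab b1 k k0; pose lam := k * ((beta - 1) ^+ 2 / beta).
have b0 : 0 < beta by exact: lt_trans b1.
have lam0 : 0 < lam by rewrite mulr_gt0 // divr_gt0 // exprn_gt0 // subr_gt0.
exists (2 / lam); first by rewrite divr_ge0 // ltW.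
move=> m n nm; have m0 : 0 < m%:R :> R by rewrite ltr0n; lia.
have -> : 2 / lam / m%:R = 2 / (lam * m%:R) :> R by rewrite -mulrA -invfM.
pose d := k * (beta ^+ m - beta ^+ n).
apply: (upper_primitive_cos _ _ _ (d *: id) (cst d) (cst 0)) => [||x xab].
- exact: ltW.
- exact: mulr_gt0.
split => //; last 2 first.
- exact: cst_continuous.
- have -> : lam * m%:R = k * (m%:R * (beta - 1) * (beta - 1) / beta) by rewrite /lam; ring.
  rewrite /d /= ler_pM2l // ler_pdivrMr //.
  have := natr_le_expr beta m (ltW b1).
  have : beta ^+ n * beta <= beta ^+ m.
    by rewrite -exprSr ler_weXn2l ?(ltW b1) //; lia.
  by nra.
- by apply: is_derive_eq; exact: mulr1.
- exact: is_derive_cst.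
Qed.

(** * Countable unions over products and segments, and the conclusion *)

Lemma ae_multilinearly_disjoint {R : realType} (c : R -> nat -> R[i]) (a b : nat -> R) :
  (forall i r (l k : 'I_r -> nat), (0 < r)%N -> (forall j, (0 < k j)%N) ->
    {ae @lebesgue_measure R, forall x, a i <= x <= b i ->
      (N%:R^-1 * \sum_(1 <= n < N.+1) \prod_(j < r) c x (n + l j)%N ^+ k j
        : R[i]^o) @[N --> \oo] --> (0 : R[i]^o)}) ->
  {ae @lebesgue_measure R, forall x, (exists i, a i <= x <= b i) ->
    multilinearly_disjoint (c x)}.
Proof.
move=> ae_c.
(* The pair [(l, k)] is encoded as a finite function because [{ffun 'I_r -> nat * nat}] is a
   countable type, so the exceptional null sets can be united. *)
have ae_t : {ae @lebesgue_measure R, forall x, forall i r,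
    forall t : {ffun 'I_r -> nat * nat},
    (0 < r)%N -> (forall j, (0 < (t j).2)%N) -> a i <= x <= b i ->
    (N%:R^-1 * \sum_(1 <= n < N.+1) \prod_(j < r) c x (n + (t j).1)%N ^+ (t j).2
      : R[i]^o) @[N --> \oo] --> (0 : R[i]^o)}.
  apply: ae_foralln => i; apply: ae_foralln => r; apply: ae_forall_countType => t.
  have [r0|r0] := boolP (0 < r)%N; last by apply: aeW.
  have [/forallP t0|t0] := boolP [forall j, 0 < (t j).2]%N; last first.
    by apply: aeW => x _ /forallP t1; rewrite t1 in t0.
  have := ae_c i r (fun j => (t j).1) (fun j => (t j).2) r0 t0.
  apply: filterS; first exact: (ae_filter_ringOfSetsType (@lebesgue_measure R)).
  by move=> x cx _ _.
move: ae_t; apply: filterS; first exact: (ae_filter_ringOfSetsType (@lebesgue_measure R)).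
move=> x ae_x [i xi] r l k r0 _ k0 _.
have [t tE] : exists t : {ffun 'I_r -> nat * nat}, forall j, t j = (l j, k j).
  by exists [ffun j => (l j, k j)] => j; rewrite ffunE.
rewrite [X in X @ _](_ : _ = fun N => N%:R^-1 * \sum_(1 <= n < N.+1)
    \prod_(j < r) c x (n + (t j).1)%N ^+ (t j).2 : R[i]^o).
  by apply: (ae_x i) => // j; rewrite tE; exact: k0.
apply/funext => N; congr (_ * _); apply: eq_bigr => n _; apply: eq_bigr => j _.
by rewrite tE.
Qed.

Lemma nat_segment_cover {R : realType} (x : R) : 1 < x ->
  exists i : nat, 1 + i.+1%:R^-1 <= x <= i.+3%:R.
Proof.
(* One summand of the index makes [i.+1] exceed [x], the other makes it exceed [1 / (x - 1)]. *)
move=> x1; exists (Num.truncn x + Num.truncn (x - 1)^-1)%N; apply/andP; split.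
  rewrite -lerBrDl -[leRHS]invrK lef_pV2 ?posrE ?invr_gt0 ?subr_gt0 //.
  by apply: le_trans (ltW (truncnS_gt _)) _; rewrite ler_nat ltnS leq_addl.
apply: le_trans (ltW (truncnS_gt _)) _; rewrite ler_nat ltnS.
by do 2![apply: leqW]; exact: leq_addr.
Qed.

Theorem theorem4 (R : realType) (g : R -> R) (hg : Ckplus 2 g) :
  (forall alpha : R, alpha != 0 ->
     {ae (@lebesgue_measure R), forall beta : R, 1 < beta ->
        multilinearly_disjoint (cseq g alpha beta)})
  /\
  (forall beta : R, 1 < beta ->
     {ae (@lebesgue_measure R), forall alpha : R,
        multilinearly_disjoint (cseq g alpha beta)}).
Proof.
split=> [alpha alpha0|beta beta1].
  suff : {ae @lebesgue_measure R, forall x,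
      (exists i : nat, 1 + i.+1%:R^-1 <= x <= i.+3%:R) ->
      multilinearly_disjoint (cseq g alpha x)}.
    apply: filterS; first exact: (ae_filter_ringOfSetsType (@lebesgue_measure R)).
    by move=> x disj x1; apply: disj; exact: nat_segment_cover.
  apply: ae_multilinearly_disjoint => i r l k r0 k0.
  pose theta n x : R := 2 * pi * alpha * (x ^+ n * (freq_poly R l k).[x]) * g x.
  have a1 : 1 < 1 + i.+1%:R^-1 :> R by rewrite ltrDl invr_gt0.
  (* The left end is at most 2, attained at [i = 0]; the right end [i.+3] keeps even that segment
     nondegenerate. *)
  have ab : 1 + i.+1%:R^-1 < i.+3%:R :> R.
    rewrite (@le_lt_trans _ _ 2) ?ltr_nat //.
    by rewrite -[2]/(1 + 1) lerD2l invf_le1 // ler1n.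
  have [K K0 KP] := upper_primitive_phase g (freq_poly R l k) _ _ hg a1 ab
    (freq_poly_nneg R r l k) (fun x => freq_poly_ge1 R r l k x r0 k0)
    (2 * pi * `|alpha|) ltac:(by rewrite !mulr_gt0 ?pi_gt0 ?normr_gt0).
  have : {ae @lebesgue_measure R, forall x, 1 + i.+1%:R^-1 <= x <= i.+3%:R ->
      (N%:R^-1 * \sum_(1 <= n < N.+1) expi (theta n x) : R[i]^o)
        @[N --> \oo] --> (0 : R[i]^o)}.
    apply: (ae_expi_averages theta _ _ K ab K0) => [n|m n nm].
      apply: measurable_funM.
        apply: measurable_funM => //; apply: measurable_funM.
          exact: measurable_funX.
        apply: measurable_funTS; apply: continuous_measurable_fun.
        exact: continuous_horner.
      apply: subspace_continuous_measurable_fun => //.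
      exact: within_continuous_Ckplus hg a1.
    have := KP m n nm; congr upper_primitive; apply/funext => x.
    (* The estimate was taken with the positive factor [2 * pi * |alpha|]; evenness of the cosine
       restores a negative [alpha]. *)
    have [a0|a0] := leP 0 alpha.
      by congr cos; rewrite /theta ger0_norm //; ring.
    by rewrite -cosN; congr cos; rewrite /theta ltr0_norm //; ring.
  apply: filterS; first exact: (ae_filter_ringOfSetsType (@lebesgue_measure R)).
  move=> x cvg_x /cvg_x; apply: cvg_trans; apply: near_eq_cvg; apply: nearW => N.
  by congr (_ * _); apply: eq_bigr => n _; rewrite cseq_prod.
suff : {ae @lebesgue_measure R, forall x,
    (exists i : nat, - i.+1%:R <= x <= i.+1%:R) ->
    multilinearly_disjoint (cseq g x beta)}.
  apply: filterS; first exact: (ae_filter_ringOfSetsType (@lebesgue_measure R)).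
  move=> x; apply; exists (Num.truncn `|x|).
  by rewrite -ler_norml ltW // truncnS_gt.
apply: (ae_multilinearly_disjoint (fun x n => cseq g x beta n)) => i r l k r0 k0.
have [gb _ _ _] := hg beta beta1.
(* For fixed [beta] the phase is [C * beta ^ n * x], linear in [x = alpha], with [C > 0] since
   [P(beta) >= 1] and [g beta > 0]. *)
pose C := 2 * pi * (freq_poly R l k).[beta] * g beta.
have C0 : 0 < C.
  rewrite !mulr_gt0 ?pi_gt0 // (lt_le_trans ltr01) //.
  exact: freq_poly_ge1 (ltW beta1).
have ab : - i.+1%:R < i.+1%:R :> R by rewrite gtrN.
have [K K0 KP] := upper_primitive_linear_phase _ _ _ ab beta1 C C0.
have : {ae @lebesgue_measure R, forall x, - i.+1%:R <= x <= i.+1%:R ->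
    (N%:R^-1 * \sum_(1 <= n < N.+1) expi (C * beta ^+ n * x) : R[i]^o)
      @[N --> \oo] --> (0 : R[i]^o)}.
  apply: (ae_expi_averages (fun n x => C * beta ^+ n * x) _ _ K ab K0) => [n|m n nm].
    exact: measurable_funM.
  have := KP m n nm; congr upper_primitive; apply/funext => x; congr cos; ring.
apply: filterS; first exact: (ae_filter_ringOfSetsType (@lebesgue_measure R)).
move=> x cvg_x /cvg_x; apply: cvg_trans; apply: near_eq_cvg; apply: nearW => N.
congr (_ * _); apply: eq_bigr => n _; rewrite cseq_prod; congr expi.
by rewrite /C; ring.
Qed.
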